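(* Let $C=b_0+K_{n=1}^{\infty}\,a_n/b_n$ be a continued fraction such that its odd convergents and its even convergents tend to different limits. Suppose further that there exist positive constants $c_1,c_2,c_3$ such that, for $i\ge1$, $$c_1\le|b_i|\le c_2\qquad\text{and}\qquad\left|\frac{a_{2i+1}}{a_{2i}}\right|\le c_3 .$$ Then $C$ does not converge generally.
   Context: $b_0+K_{n=1}^{\infty}a_n/b_n$ denotes the continued fraction $b_0+\cfrac{a_1}{b_1+\cfrac{a_2}{b_2+\cfrac{a_3}{b_3+\ddots}}}$ with complex entries and, as usual for continued fractions, all $a_n\neq0$. Its $n$-th convergent is $A_n/B_n$, where $A_{-1}=1$, $A_0=b_0$, $B_{-1}=0$, $B_0=1$, $A_n=b_nA_{n-1}+a_nA_{n-2}$, $B_n=b_nB_{n-1}+a_nB_{n-2}$ for $n\ge1$. Convergents and limits are taken in $\hat{\mathbb{C}}=\mathbb{C}\cup\{\infty\}$. Use the chordal metric $d(w,z)=\dfrac{|z-w|}{\sqrt{1+|w|^2}\sqrt{1+|z|^2}}$ for finite $w,z$, $d(w,\infty)=\dfrac{1}{\sqrt{1+|w|^2}}$ for finite $w$, and $d(\infty,\infty)=0$. Put $$S_n(w)=b_0+\cfrac{a_1}{b_1+\ddots+\cfrac{a_n}{b_n+w}}=\frac{A_n+wA_{n-1}}{B_n+wB_{n-1}},\qquad S_n(\infty)=\frac{A_{n-1}}{B_{n-1}}.$$ The continued fraction converges generally to $f\in\hat{\mathbb{C}}$ if there exist sequences $\{v_n\},\{w_n\}\subset\hat{\mathbb{C}}$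 with $\liminf_{n\to\infty} d(v_n,w_n)>0$ and $\lim_{n\to\infty}S_n(v_n)=\lim_{n\to\infty}S_n(w_n)=f$. It converges generally if it converges generally to some $f\in\hat{\mathbb{C}}$. *)

(* Defs.v *)
From Stdlib Require Import Reals Lra Lia.
From Coquelicot Require Import Coquelicot.

(** Stdlib reals and Coquelicot: complex numbers are Coquelicot's [C]. *)

Local Open Scope C_scope.

Inductive Chat : Set :=
| Fin (z : C)
| Infty.

(** The value [z / w] in [Chat].  The junk value [0 / 0 = Infty] is never
    reached by convergents or by [cf_S] when all partial numerators are nonzero,
    since then [A_n B_(n-1) - A_(n-1) B_n <> 0]. *)
Definition Cquot (z w : C) : Chat :=
  if Ceq_dec w 0 then Infty else Fin (z / w).

Definition chordal (x y : Chat) : R :=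
  match x, y with
  | Fin w, Fin z => (Cmod (z - w) / (sqrt (1 + Cmod w ^ 2) * sqrt (1 + Cmod z ^ 2)))%R
  | Fin w, Infty | Infty, Fin w => (1 / sqrt (1 + Cmod w ^ 2))%R
  | Infty, Infty => 0%R
  end.

Definition is_lim_Chat (u : nat -> Chat) (l : Chat) : Prop :=
  is_lim_seq (fun n => chordal (u n) l) 0%R.

(** The continued fraction [b 0 + K_(n>=1) (a n / b n)] is given by two
    sequences [a b : nat -> C]; the value [a 0] is never used.

    To accommodate [A_(-1)] and [B_(-1)], indices are shifted by one:
    [cf_num a b k] is [A_(k-1)] and [cf_den a b k] is [B_(k-1)]. *)
Fixpoint cf_num (a b : nat -> C) (k : nat) : C :=
  match k with
  | O => 1
  | S n =>
      match n with
      | O => b O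
      | S m => b n * cf_num a b n + a n * cf_num a b m
      end
  end.

Fixpoint cf_den (a b : nat -> C) (k : nat) : C :=
  match k with
  | O => 0
  | S n =>
      match n with
      | O => 1
      | S m => b n * cf_den a b n + a n * cf_den a b m
      end
  end.

Definition cf_convergent (a b : nat -> C) (n : nat) : Chat :=
  Cquot (cf_num a b (S n)) (cf_den a b (S n)).

Definition cf_S (a b : nat -> C) (n : nat) (w : Chat) : Chat :=
  match w with
  | Fin w =>
      Cquot (cf_num a b (S n) + w * cf_num a b n)
            (cf_den a b (S n) + w * cf_den a b n)
  | Infty => Cquot (cf_num a b n) (cf_den a b n)
  end.

Definition converges_generally_to (a b : nat -> C) (f : Chat) : Prop :=
  exists v w : nat -> Chat,
    Rbar_lt 0%R (LimInf_seq (fun n => chordal (v n) (w n))) /\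
    is_lim_Chat (fun n => cf_S a b n (v n)) f /\
    is_lim_Chat (fun n => cf_S a b n (w n)) f.

Definition converges_generally (a b : nat -> C) : Prop :=
  exists f : Chat, converges_generally_to a b f.

(** The next facts confirm that the closed formula used in [cf_S] agrees with
    the nested fraction [b_0 + a_1 / (b_1 + ... + a_n / (b_n + w))]. *)

Lemma Cquot_scale (k z w : C) : k <> 0 -> Cquot (k * z) (k * w) = Cquot z w.
Proof.
intros Hk; unfold Cquot.
destruct (Ceq_dec w 0) as [-> | Hw];
  destruct (Ceq_dec _ 0) as [H | H]; try reflexivity.
- exfalso; apply H; ring.
- exfalso; exact (Cmult_neq_0 _ _ Hk Hw H).
- f_equal; field; auto.
Qed.

Lemma cf_S_0 (a b : nat -> C) (w : Chat) :
  cf_S a b 0 w = match w with Fin w => Fin (b O + w) | Infty => Infty end.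
Proof.
destruct w as [w |]; simpl; unfold Cquot.
- destruct (Ceq_dec _ 0) as [H | H].
  + exfalso; replace (1 + w * 0) with (RtoC 1) in H by ring.
    exact (C1_nz H).
  + f_equal; field; intros H1; exact (C1_nz H1).
- destruct (Ceq_dec 0 0) as [_ | H]; [reflexivity | now contradict H].
Qed.

Lemma cf_S_S (a b : nat -> C) (n : nat) (w : Chat) : a (S n) <> 0 ->
  cf_S a b (S n) w =
  cf_S a b n (match w with
              | Fin w => Cquot (a (S n)) (b (S n) + w)
              | Infty => Fin 0
              end).
Proof.
intros Ha.
assert (Enum : cf_num a b (S (S n)) =
  b (S n) * cf_num a b (S n) + a (S n) * cf_num a b n) by reflexivity.
assert (Eden : cf_den a b (S (S n)) =
  b (S n) * cf_den a b (S n) + a (S n) * cf_den a b n) by reflexivity.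
unfold cf_S at 1; rewrite Enum, Eden.
destruct w as [w |].
- unfold Cquot at 2; destruct (Ceq_dec (b (S n) + w) 0) as [H | H].
  + unfold cf_S; rewrite <- (Cquot_scale (a (S n)) (cf_num a b n)) by exact Ha.
    replace w with (- b (S n)).
    * f_equal; ring.
    * replace w with (b (S n) + w - b (S n)) by ring; rewrite H; ring.
  + unfold cf_S; symmetry.
    rewrite <- (Cquot_scale (b (S n) + w)) by exact H.
    f_equal; field; exact H.
- unfold cf_S; f_equal; ring.
Qed.

(* Main.v *)
Require Import Defs.
From Stdlib Require Import Reals Lra Lia.
From Coquelicot Require Import Coquelicot.

(** Write [p_n] for the convergents and [P_n = (A_n, B_n)], a vector of [C^2]
    whose class is [p_n].  For vectors [x], [y] of [C^2] the chordal distance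
    is the homogeneous quotient [d([x], [y]) = |x /\ y| / (|x| |y|)], where
    [x /\ y] is the 2 by 2 determinant ([chordal_Cquot]).

    The recurrence says [b_n P_(n-1) = P_n - a_n P_(n-2)].  Taking the wedge
    with [P_n] turns it into [|b_n| |P_n /\ P_(n-1)| = |a_n| |P_n /\ P_(n-2)|],
    and taking norms gives [|a_n P_(n-2)| <= |P_n| + |b_n| |P_(n-1)|]; together

      [|b_n| |P_(n-1)| d(p_n, p_(n-1))
         <= d(p_n, p_(n-2)) (|P_n| + |b_n| |P_(n-1)|)]

    ([cf_norm_step]).  Since the odd and the even convergents have different
    limits, [d(p_n, p_(n-1))] stays away from [0] while [d(p_n, p_(n-2))] tends
    to [0]; as [|b_n| >= c_1], this forces [|P_(n-1)| / |P_n| -> 0]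
    ([cf_norm_ratio]).

    Now [S_n(w)] is the class of [P_n + w P_(n-1)].  For [w] in a bounded set
    this vector is a relatively small perturbation of [P_n], so
    [d(S_n(w), p_n) -> 0] uniformly there ([cf_S_close_to_convergent]).  If the
    continued fraction converged generally to [f] along [v_n] and [w_n], then, the two sequences
    being eventually a fixed distance apart, one of [v_n], [w_n] would lie at
    each stage [n] in a fixed bounded set, whence [p_n -> f].  The odd and even
    limits would then coincide. *)

Local Open Scope R_scope.

(** * Norm and determinant on pairs of complex numbers *)

Definition hnorm (z w : C) : R := sqrt (Cmod z ^ 2 + Cmod w ^ 2).

Definition wedge (z w z' w' : C) : C := (z * w' - w * z')%C.

Lemma hnorm_gt_0 (z w : C) : (z <> 0 \/ w <> 0)%C -> 0 < hnorm z w.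
Proof.
intros H; apply sqrt_lt_R0.
pose proof (Cmod_ge_0 z); pose proof (Cmod_ge_0 w).
destruct H as [H | H]; apply Cmod_gt_0 in H; nra.
Qed.

Lemma hnorm_scal (k z w : C) : hnorm (k * z) (k * w) = Cmod k * hnorm z w.
Proof.
unfold hnorm; rewrite !Cmod_mult.
replace ((Cmod k * Cmod z) ^ 2 + (Cmod k * Cmod w) ^ 2)
  with (Cmod k ^ 2 * (Cmod z ^ 2 + Cmod w ^ 2)) by ring.
rewrite sqrt_mult by nra.
now rewrite sqrt_pow2 by apply Cmod_ge_0.
Qed.

(** This is Minkowski's inequality for the Euclidean norm of the plane, which
    is [Cmod], applied to the vectors of moduli. *)
Lemma hnorm_triangle (z w z' w' : C) :
  hnorm (z + z') (w + w') <= hnorm z w + hnorm z' w'.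
Proof.
apply Rle_trans with (Cmod (Cmod z + Cmod z', Cmod w + Cmod w')).
- apply sqrt_le_1_alt; simpl fst; simpl snd.
  apply Rplus_le_compat; apply pow_incr; split;
    auto using Cmod_ge_0, Cmod_triangle.
- exact (Cmod_triangle (Cmod z, Cmod w) (Cmod z', Cmod w')).
Qed.

(** Squared, and after bounding the determinant by the sum of the moduli of its
    two terms, this is the Cauchy-Schwarz inequality for moduli. *)
Lemma Cmod_wedge_le (z w z' w' : C) :
  Cmod (wedge z w z' w') <= hnorm z w * hnorm z' w'.
Proof.
apply Rle_trans with (Cmod z * Cmod w' + Cmod w * Cmod z').
- unfold wedge, Cminus; eapply Rle_trans; [apply Cmod_triangle |].
  rewrite Cmod_opp, !Cmod_mult; lra.
- unfold hnorm; rewrite <- sqrt_mult by nra.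
  apply Rsqr_incr_0_var; [| apply sqrt_pos].
  rewrite Rsqr_sqrt by nra; unfold Rsqr.
  pose proof (pow2_ge_0 (Cmod z * Cmod z' - Cmod w * Cmod w')); nra.
Qed.

(** Any three vectors of a plane satisfy
    [(x1 /\ x3) x2 = (x1 /\ x2) x3 + (x2 /\ x3) x1]; take norms.  Divided by
    the three norms, this becomes the triangle inequality for [chordal]. *)
Lemma wedge_triangle (z1 w1 z2 w2 z3 w3 : C) :
  Cmod (wedge z1 w1 z3 w3) * hnorm z2 w2 <=
  Cmod (wedge z1 w1 z2 w2) * hnorm z3 w3 + Cmod (wedge z2 w2 z3 w3) * hnorm z1 w1.
Proof.
rewrite <- !hnorm_scal.
replace (wedge z1 w1 z3 w3 * z2)%C
  with (wedge z1 w1 z2 w2 * z3 + wedge z2 w2 z3 w3 * z1)%C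
  by (unfold wedge; ring).
replace (wedge z1 w1 z3 w3 * w2)%C
  with (wedge z1 w1 z2 w2 * w3 + wedge z2 w2 z3 w3 * w1)%C
  by (unfold wedge; ring).
apply hnorm_triangle.
Qed.

Lemma hnorm_factor (z w : C) : w <> 0%C ->
  hnorm z w = Cmod w * sqrt (1 + Cmod (z / w)%C ^ 2).
Proof.
intros Hw; pose proof (hnorm_scal w (z / w) 1) as H.
replace (w * (z / w))%C with z in H by (field; exact Hw).
replace (w * 1)%C with w in H by ring.
rewrite H; unfold hnorm; rewrite Cmod_1; do 2 f_equal; ring.
Qed.

Lemma hnorm_0_r (z : C) : hnorm z 0 = Cmod z.
Proof.
unfold hnorm; rewrite Cmod_0.
replace (Cmod z ^ 2 + 0 ^ 2) with (Cmod z ^ 2) by ring.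
apply sqrt_pow2, Cmod_ge_0.
Qed.

(** * The chordal metric in homogeneous coordinates *)

Lemma sqrt_1_plus_gt_0 (z : C) : 0 < sqrt (1 + Cmod z ^ 2).
Proof. apply sqrt_lt_R0; nra. Qed.

Lemma chordal_sym (x y : Chat) : chordal x y = chordal y x.
Proof.
destruct x as [x |], y as [y |]; simpl; try reflexivity.
replace (y - x)%C with (- (x - y))%C by ring.
now rewrite Cmod_opp, (Rmult_comm (sqrt (1 + Cmod x * (Cmod x * 1)))).
Qed.

Lemma chordal_ge_0 (x y : Chat) : 0 <= chordal x y.
Proof.
pose proof sqrt_1_plus_gt_0 as Hs.
destruct x as [x |], y as [y |]; unfold chordal; try lra;
  apply Rle_mult_inv_pos; auto using Cmod_ge_0, Rmult_lt_0_compat, Rle_0_1.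
Qed.

(** The product form avoids all nonvanishing hypotheses: if one of the two pairs
    is [(0, 0)], both sides vanish. *)
Lemma chordal_Cquot (z w z' w' : C) :
  chordal (Cquot z w) (Cquot z' w') * hnorm z w * hnorm z' w' =
  Cmod (wedge z w z' w').
Proof.
assert (Hs : forall z, sqrt (1 + Cmod z ^ 2) <> 0)
  by (intros t; apply Rgt_not_eq, sqrt_1_plus_gt_0).
unfold Cquot, wedge.
destruct (Ceq_dec w 0) as [-> | Hw], (Ceq_dec w' 0) as [-> | Hw'];
  unfold chordal.
- replace (z * 0 - 0 * z')%C with (RtoC 0) by ring; rewrite Cmod_0; ring.
- rewrite hnorm_0_r, (hnorm_factor z' w') by exact Hw'.
  replace (z * w' - 0 * z')%C with (z * w')%C by ring.
  rewrite Cmod_mult; field; apply Hs.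
- rewrite hnorm_0_r, (hnorm_factor z w) by exact Hw.
  replace (z * 0 - w * z')%C with (- (w * z'))%C by ring.
  rewrite Cmod_opp, Cmod_mult; field; apply Hs.
- rewrite (hnorm_factor z w), (hnorm_factor z' w') by assumption.
  replace (z * w' - w * z')%C with (- (w * w' * (z' / w' - z / w)))%C
    by (field; auto).
  rewrite Cmod_opp, !Cmod_mult; field; split; apply Hs.
Qed.

Lemma Chat_homogeneous (x : Chat) :
  exists z w, x = Cquot z w /\ 0 < hnorm z w.
Proof.
destruct x as [z |].
- exists z, (RtoC 1); split.
  + unfold Cquot; destruct (Ceq_dec 1 0) as [H | H].
    * now destruct C1_nz.
    * f_equal; field; exact C1_nz.
  + apply hnorm_gt_0; right; exact C1_nz.
- exists (RtoC 1), (RtoC 0); split.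
  + unfold Cquot; now destruct (Ceq_dec 0 0).
  + apply hnorm_gt_0; left; exact C1_nz.
Qed.

Lemma chordal_triangle (x y z : Chat) :
  chordal x z <= chordal x y + chordal y z.
Proof.
destruct (Chat_homogeneous x) as (x1 & x2 & -> & Hx).
destruct (Chat_homogeneous y) as (y1 & y2 & -> & Hy).
destruct (Chat_homogeneous z) as (z1 & z2 & -> & Hz).
apply Rmult_le_reg_r with (hnorm x1 x2 * hnorm y1 y2 * hnorm z1 z2);
  [now repeat apply Rmult_lt_0_compat |].
pose proof (wedge_triangle x1 x2 y1 y2 z1 z2) as H.
rewrite <- !chordal_Cquot in H; lra.
Qed.

Lemma chordal_eq_0 (x y : Chat) : chordal x y = 0 -> x = y.
Proof.
pose proof sqrt_1_plus_gt_0 as Hs.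
destruct x as [x |], y as [y |]; unfold chordal; intros H; try reflexivity.
- assert (Hm : Cmod (y - x) = 0).
  { rewrite <- (Rmult_0_l (sqrt (1 + Cmod x ^ 2) * sqrt (1 + Cmod y ^ 2))), <- H.
    field; split; apply Rgt_not_eq, Hs. }
  apply Cmod_eq_0 in Hm.
  f_equal; replace y with (y - x + x)%C by ring; rewrite Hm; ring.
- pose proof (Rdiv_lt_0_compat 1 _ Rlt_0_1 (Hs x)); lra.
- pose proof (Rdiv_lt_0_compat 1 _ Rlt_0_1 (Hs y)); lra.
Qed.

(** Being away from [Infty] means being bounded, with an explicit bound. *)
Lemma Cmod_lt_of_chordal_Infty (w : C) (r : R) : 0 < r ->
  r <= chordal (Fin w) Infty -> Cmod w < / r.
Proof.
intros Hr H; unfold chordal in H.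
pose proof (sqrt_1_plus_gt_0 w) as Hs.
apply Rlt_le_trans with (sqrt (1 + Cmod w ^ 2)).
- rewrite <- (sqrt_pow2 (Cmod w)) at 1 by apply Cmod_ge_0.
  apply sqrt_lt_1_alt; nra.
- rewrite <- (Rinv_inv (sqrt _)); apply Rinv_le_contravar; lra.
Qed.

(** * Limits *)

Lemma is_lim_Chat_eventually (u : nat -> Chat) (l : Chat) :
  is_lim_Chat u l <->
  forall eps, 0 < eps -> eventually (fun n => chordal (u n) l < eps).
Proof.
unfold is_lim_Chat; rewrite <- is_lim_seq_spec; unfold is_lim_seq'.
split; intros H.
- intros eps Heps; apply (filter_imp _ _) with (2 := H (mkposreal eps Heps)).
  intros n; simpl; rewrite Rminus_0_r, Rabs_pos_eq; auto using chordal_ge_0.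
- intros eps; apply (filter_imp _ _) with (2 := H eps (cond_pos eps)).
  intros n; rewrite Rminus_0_r, Rabs_pos_eq; auto using chordal_ge_0.
Qed.

Lemma eventually_even_odd (P : nat -> Prop) :
  eventually (fun n => P (2 * n)%nat) -> eventually (fun n => P (2 * n + 1)%nat) ->
  eventually P.
Proof.
intros [N HN] [M HM]; exists (2 * (N + M) + 1)%nat; intros n Hn.
destruct (Nat.Even_or_Odd n) as [[k ->] | [k ->]].
- apply HN; lia.
- apply HM; lia.
Qed.

Lemma LimInf_seq_gt_0 (u : nat -> R) :
  Rbar_lt 0 (LimInf_seq u) -> exists r, 0 < r /\ eventually (fun n => r <= u n).
Proof.
intros Hpos; pose proof (proj2_sig (ex_LimInf_seq u)) as H.
change (proj1_sig (ex_LimInf_seq u)) with (LimInf_seq u) in H.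
destruct (LimInf_seq u) as [l | |]; simpl in Hpos; [| | contradiction].
- assert (Hl : 0 < l / 2) by lra.
  destruct (H (mkposreal _ Hl)) as [_ [N HN]]; simpl in HN.
  exists (l / 2); split; [exact Hl | exists N; intros n Hn].
  specialize (HN n Hn); lra.
- destruct (H 1) as [N HN]; exists 1; split; [lra | exists N; intros n Hn].
  specialize (HN n Hn); lra.
Qed.

(** * Growth of the convergents *)

(** With the shifted indices of [cf_num] and [cf_den], [cf_norm a b k] is the
    norm of [P_(k-1) = (A_(k-1), B_(k-1))]. *)
Definition cf_norm (a b : nat -> C) (k : nat) : R :=
  hnorm (cf_num a b k) (cf_den a b k).

(** The determinant of two consecutive pairs is, up to sign, the product of the
    [a_i], hence nonzero. *)
Lemma cf_norm_gt_0 (a b : nat -> C) (k : nat) :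
  (forall n : nat, (1 <= n)%nat -> a n <> RtoC 0) -> 0 < cf_norm a b k.
Proof.
intros Ha.
assert (Hw : wedge (cf_num a b (S k)) (cf_den a b (S k))
                   (cf_num a b k) (cf_den a b k) <> 0%C).
{ induction k as [| k IH].
  - unfold wedge; simpl.
    replace (b 0%nat * 0 - 1 * 1)%C with (- (1))%C by ring.
    intros H; apply C1_nz.
    replace (RtoC 1) with (- - (1))%C by ring; rewrite H; ring.
  - replace (wedge _ _ _ _) with
      (- a (S k) * wedge (cf_num a b (S k)) (cf_den a b (S k))
                         (cf_num a b k) (cf_den a b k))%C.
    + apply Cmult_neq_0; [| exact IH].
      intros H; apply (Ha (S k)); [lia |].
      replace (a (S k)) with (- - a (S k))%C by ring; rewrite H; ring.
    + change (cf_num a b (S (S k))) with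
        (b (S k) * cf_num a b (S k) + a (S k) * cf_num a b k)%C.
      change (cf_den a b (S (S k))) with
        (b (S k) * cf_den a b (S k) + a (S k) * cf_den a b k)%C.
      unfold wedge; ring. }
apply hnorm_gt_0.
destruct (Ceq_dec (cf_num a b k) 0) as [Hn |]; [| now left].
destruct (Ceq_dec (cf_den a b k) 0) as [Hd |]; [| now right].
exfalso; apply Hw; rewrite Hn, Hd; unfold wedge; ring.
Qed.

(** The three-term recurrence read in two ways: its wedge with [P_(n+2)] relates
    the two chordal distances, and its norm bounds the remaining factor
    [|a_(n+2)| |P_n|].  Eliminating [a_(n+2)] leaves an estimate in which only
    [b_(n+2)] occurs. *)
Lemma cf_norm_step (a b : nat -> C) (n : nat) :
  (forall n : nat, (1 <= n)%nat -> a n <> RtoC 0) ->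
  Cmod (b (S (S n))) * cf_norm a b (S (S n)) *
    chordal (cf_convergent a b (S (S n))) (cf_convergent a b (S n)) <=
  chordal (cf_convergent a b (S (S n))) (cf_convergent a b n) *
    (cf_norm a b (S (S (S n))) + Cmod (b (S (S n))) * cf_norm a b (S (S n))).
Proof.
intros Ha; unfold cf_convergent.
set (k := S n).
pose proof (cf_norm_gt_0 a b (S (S k)) Ha) as Hpos; unfold cf_norm in *.
assert (En : cf_num a b (S (S k)) =
  (b (S k) * cf_num a b (S k) + a (S k) * cf_num a b k)%C) by reflexivity.
assert (Ed : cf_den a b (S (S k)) =
  (b (S k) * cf_den a b (S k) + a (S k) * cf_den a b k)%C) by reflexivity.
set (x := cf_num a b (S (S k))) in *; set (x' := cf_den a b (S (S k))) in *.
set (y := cf_num a b (S k)) in *; set (y' := cf_den a b (S k)) in *.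
set (z := cf_num a b k) in *; set (z' := cf_den a b k) in *.
set (al := a (S k)) in *; set (be := b (S k)) in *.
pose proof (chordal_Cquot x x' y y') as Hxy.
pose proof (chordal_Cquot x x' z z') as Hxz.
assert (Hw : Cmod be * Cmod (wedge x x' y y') = Cmod al * Cmod (wedge x x' z z')).
{ rewrite <- !Cmod_mult, <- (Cmod_opp (al * _)); f_equal.
  rewrite En, Ed; unfold wedge; ring. }
rewrite <- Hxy, <- Hxz in Hw.
assert (Hz : Cmod al * hnorm z z' <= hnorm x x' + Cmod be * hnorm y y').
{ rewrite <- hnorm_scal.
  replace (al * z)%C with (x + (- be) * y)%C by (rewrite En; ring).
  replace (al * z')%C with (x' + (- be) * y')%C by (rewrite Ed; ring).
  eapply Rle_trans; [apply hnorm_triangle |].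
  rewrite hnorm_scal, Cmod_opp; lra. }
apply Rle_trans with (chordal (Cquot x x') (Cquot z z') * (Cmod al * hnorm z z')).
- apply Req_le, Rmult_eq_reg_r with (hnorm x x'); lra.
- apply Rmult_le_compat_l; [apply chordal_ge_0 | exact Hz].
Qed.

(** The determinant of [P_n + w P_(n-1)] and [P_n] is [w] times that of
    [P_(n-1)] and [P_n], and [|P_n + w P_(n-1)| >= |P_n| - |w| |P_(n-1)|]. *)
Lemma chordal_cf_S_le (a b : nat -> C) (n : nat) (w : C) :
  (forall n : nat, (1 <= n)%nat -> a n <> RtoC 0) ->
  chordal (cf_S a b n (Fin w)) (cf_convergent a b n) *
    (cf_norm a b (S n) - Cmod w * cf_norm a b n) <=
  Cmod w * cf_norm a b n.
Proof.
intros Ha; pose proof (cf_norm_gt_0 a b (S n) Ha) as Hpos.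
unfold cf_S, cf_convergent, cf_norm in *.
set (x := cf_num a b (S n)) in *; set (x' := cf_den a b (S n)) in *.
set (y := cf_num a b n) in *; set (y' := cf_den a b n) in *.
pose proof (chordal_Cquot (x + w * y) (x' + w * y') x x') as H.
replace (wedge (x + w * y) (x' + w * y') x x') with (w * wedge y y' x x')%C in H
  by (unfold wedge; ring).
rewrite Cmod_mult in H.
pose proof (Cmod_wedge_le y y' x x') as Hyx.
assert (Hx : hnorm x x' <= hnorm (x + w * y) (x' + w * y') + Cmod w * hnorm y y').
{ rewrite <- (Cmod_opp w), <- hnorm_scal.
  eapply Rle_trans; [| apply hnorm_triangle].
  apply Req_le; f_equal; ring. }
apply Rle_trans with (chordal (Cquot (x + w * y) (x' + w * y')) (Cquot x x') *
    hnorm (x + w * y) (x' + w * y')).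
- apply Rmult_le_compat_l; [apply chordal_ge_0 | lra].
- apply Rmult_le_reg_r with (hnorm x x'); [exact Hpos |].
  rewrite H, Rmult_assoc.
  apply Rmult_le_compat_l; [apply Cmod_ge_0 | exact Hyx].
Qed.

(** * Consequences of distinct odd and even limits *)

Lemma parity_limits (u : nat -> Chat) (f_odd f_even : Chat) :
  is_lim_Chat (fun n => u (2 * n + 1)%nat) f_odd ->
  is_lim_Chat (fun n => u (2 * n)%nat) f_even ->
  forall eps, 0 < eps -> eventually (fun n =>
    chordal (u n) (if Nat.even n then f_even else f_odd) < eps).
Proof.
intros Ho He eps Heps.
rewrite is_lim_Chat_eventually in Ho, He.
apply eventually_even_odd.
- apply (filter_imp _ _) with (2 := He eps Heps); intros n.
  now rewrite Nat.even_mul.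
- apply (filter_imp _ _) with (2 := Ho eps Heps); intros n.
  now rewrite Nat.even_add, Nat.even_mul.
Qed.

Lemma eventually_shift (P : nat -> Prop) (k : nat) :
  eventually P -> eventually (fun n => P (k + n)%nat).
Proof. intros [N HN]; exists N; intros n Hn; apply HN; lia. Qed.

Lemma two_step_close (u : nat -> Chat) (f_odd f_even : Chat) :
  is_lim_Chat (fun n => u (2 * n + 1)%nat) f_odd ->
  is_lim_Chat (fun n => u (2 * n)%nat) f_even ->
  forall eps, 0 < eps -> eventually (fun n => chordal (u (S (S n))) (u n) < eps).
Proof.
intros Ho He eps Heps.
assert (Hu := parity_limits u f_odd f_even Ho He (eps / 2) ltac:(lra)).
apply (filter_imp _ _) with (2 := filter_and _ _ Hu (eventually_shift _ 2 Hu)).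
intros n [H0 H2]; change (2 + n)%nat with (S (S n)) in H2.
change (Nat.even (S (S n))) with (Nat.even n) in H2.
set (g := if Nat.even n then f_even else f_odd) in *.
pose proof (chordal_triangle (u (S (S n))) g (u n)) as H.
rewrite (chordal_sym g) in H; lra.
Qed.

Lemma consecutive_apart (u : nat -> Chat) (f_odd f_even : Chat) :
  is_lim_Chat (fun n => u (2 * n + 1)%nat) f_odd ->
  is_lim_Chat (fun n => u (2 * n)%nat) f_even ->
  f_odd <> f_even ->
  exists eta, 0 < eta /\ eventually (fun n => eta <= chordal (u (S n)) (u n)).
Proof.
intros Ho He Hne.
assert (Hd : 0 < chordal f_odd f_even).
{ destruct (chordal_ge_0 f_odd f_even) as [H | H]; [exact H |].
  now destruct Hne; apply chordal_eq_0. }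
set (d := chordal f_odd f_even) in *.
exists (d / 2); split; [lra |].
assert (Hu := parity_limits u f_odd f_even Ho He (d / 4) ltac:(lra)).
apply (filter_imp _ _) with (2 := filter_and _ _ Hu (eventually_shift _ 1 Hu)).
intros n [H0 H1]; change (1 + n)%nat with (S n) in H1.
rewrite Nat.even_succ, <- Nat.negb_even in H1.
set (g := if Nat.even n then f_even else f_odd) in *.
set (h := if negb (Nat.even n) then f_even else f_odd) in *.
assert (Hgh : chordal h g = d).
{ unfold g, h, d; destruct (Nat.even n); [reflexivity | apply chordal_sym]. }
pose proof (chordal_triangle h (u (S n)) g).
pose proof (chordal_triangle (u (S n)) (u n) g).
rewrite (chordal_sym h (u (S n))) in *; lra.
Qed.

(** Write [Z = |b_n| |P_(n-1)|] and [X = |P_n|].  Once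
    [d(p_n, p_(n-1)) >= eta] and [d(p_n, p_(n-2)) < eps], the basic estimate
    gives [Z eta <= eps (X + Z)], so that [Z] is small relative to [X]; the lower
    bound on [|b_n|] passes this on to [|P_(n-1)|]. *)
Lemma cf_norm_ratio (a b : nat -> C) (f_odd f_even : Chat) (c : R) :
  (forall n : nat, (1 <= n)%nat -> a n <> RtoC 0) ->
  is_lim_Chat (fun n => cf_convergent a b (2 * n + 1)%nat) f_odd ->
  is_lim_Chat (fun n => cf_convergent a b (2 * n)%nat) f_even ->
  f_odd <> f_even ->
  0 < c -> (forall n : nat, (1 <= n)%nat -> c <= Cmod (b n)) ->
  forall kappa, 0 < kappa ->
    eventually (fun n => cf_norm a b n <= kappa * cf_norm a b (S n)).
Proof.
intros Ha Ho He Hne Hc Hb kappa Hk.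
destruct (consecutive_apart _ _ _ Ho He Hne) as (eta & Heta & Hapart).
(* The first bound absorbs [eps * Z] into [Z * eta]; the second one then turns
   [eps * X] into the wanted multiple of [X]. *)
set (eps := Rmin (eta / 2) (kappa * c * (eta / 2))).
assert (Heps : 0 < eps).
{ apply Rmin_glb_lt; [lra |]; repeat apply Rmult_lt_0_compat; lra. }
pose proof (Rmin_l (eta / 2) (kappa * c * (eta / 2))) as Hm1.
pose proof (Rmin_r (eta / 2) (kappa * c * (eta / 2))) as Hm2.
fold eps in Hm1, Hm2.
pose proof (two_step_close _ _ _ Ho He eps Heps) as Hclose.
destruct (eventually_shift _ 1 Hapart) as [N1 HN1], Hclose as [N2 HN2].
exists (S (S (N1 + N2))); intros n Hn.
destruct n as [| [| n]]; try lia.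
specialize (HN1 n ltac:(lia)); specialize (HN2 n ltac:(lia)).
change (1 + n)%nat with (S n) in HN1.
pose proof (cf_norm_step a b n Ha) as Hstep.
pose proof (cf_norm_gt_0 a b (S (S n)) Ha) as Hy.
pose proof (cf_norm_gt_0 a b (S (S (S n))) Ha) as Hx.
specialize (Hb (S (S n)) ltac:(lia)).
set (Y := cf_norm a b (S (S n))) in *; set (X := cf_norm a b (S (S (S n)))) in *.
set (Z := Cmod (b (S (S n))) * Y) in *.
assert (HZ : c * Y <= Z) by (apply Rmult_le_compat_r; lra).
assert (HcY : 0 < c * Y) by (apply Rmult_lt_0_compat; lra).
assert (H1 : Z * eta <= eps * (X + Z)).
{ eapply Rle_trans; [apply Rmult_le_compat_l; [lra | exact HN1] |].
  eapply Rle_trans; [exact Hstep |].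
  apply Rmult_le_compat_r; lra. }
assert (H2 : Z * (eta / 2) <= kappa * c * (eta / 2) * X).
{ apply (Rmult_le_compat_r Z) in Hm1; [| lra].
  apply (Rmult_le_compat_r X) in Hm2; lra. }
apply Rmult_le_reg_l with (c * (eta / 2)); [apply Rmult_lt_0_compat; lra |].
apply (Rmult_le_compat_r (eta / 2)) in HZ; lra.
Qed.

(** Uniformity in [x] is essential: it is applied at a point that changes with
    [n] and is taken sometimes from one sequence, sometimes from another. *)
Lemma cf_S_close_to_convergent (a b : nat -> C) (f_odd f_even : Chat) (c : R) :
  (forall n : nat, (1 <= n)%nat -> a n <> RtoC 0) ->
  is_lim_Chat (fun n => cf_convergent a b (2 * n + 1)%nat) f_odd ->
  is_lim_Chat (fun n => cf_convergent a b (2 * n)%nat) f_even ->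
  f_odd <> f_even ->
  0 < c -> (forall n : nat, (1 <= n)%nat -> c <= Cmod (b n)) ->
  forall r eps, 0 < r -> 0 < eps ->
    eventually (fun n => forall x, r <= chordal x Infty ->
      chordal (cf_S a b n x) (cf_convergent a b n) <= eps).
Proof.
intros Ha Ho He Hne Hc Hb r eps Hr Heps.
(* For [|w| < 1 / r] this makes [t = |w| |P_(n-1)| / |P_n|] at most
   [eps / (1 + eps)], which is equivalent to [t / (1 - t) <= eps]. *)
set (kappa := r * (eps / (1 + eps))).
assert (Hk : 0 < kappa).
{ apply Rmult_lt_0_compat; [| apply Rdiv_lt_0_compat]; lra. }
apply (filter_imp _ _) with
  (2 := cf_norm_ratio a b f_odd f_even c Ha Ho He Hne Hc Hb kappa Hk).
intros n Hn [w |] Hw; [| simpl in Hw; lra].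
apply Cmod_lt_of_chordal_Infty in Hw; [| exact Hr].
pose proof (chordal_cf_S_le a b n w Ha) as H.
pose proof (cf_norm_gt_0 a b n Ha); pose proof (cf_norm_gt_0 a b (S n) Ha).
set (D := chordal _ _) in *; set (X := cf_norm a b (S n)) in *.
set (Y := cf_norm a b n) in *.
assert (HwY : (1 + eps) * (Cmod w * Y) <= eps * X).
{ apply Rle_trans with ((1 + eps) * (/ r * (kappa * X))).
  - apply Rmult_le_compat_l; [lra |].
    apply Rmult_le_compat; auto using Cmod_ge_0; lra.
  - apply Req_le; unfold kappa; field; lra. }
pose proof (Cmod_ge_0 w).
assert (0 <= Cmod w * Y) by (apply Rmult_le_pos; lra).
assert (0 < X - Cmod w * Y).
{ assert (0 < (1 + eps) * (X - Cmod w * Y)) by lra.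
  apply Rmult_lt_reg_l with (1 + eps); lra. }
apply Rmult_le_reg_r with (X - Cmod w * Y); lra.
Qed.

Theorem proposition3 :
  forall (a b : nat -> C),
    (forall n : nat, (1 <= n)%nat -> a n <> RtoC 0) ->
    (exists f_odd f_even : Chat,
        is_lim_Chat (fun n => cf_convergent a b (2 * n + 1)%nat) f_odd /\
        is_lim_Chat (fun n => cf_convergent a b (2 * n)%nat) f_even /\
        f_odd <> f_even) ->
    (exists c1 c2 c3 : R,
        (0 < c1)%R /\ (0 < c2)%R /\ (0 < c3)%R /\
        forall i : nat, (1 <= i)%nat ->
          (c1 <= Cmod (b i) <= c2)%R /\
          (Cmod (a (2 * i + 1)%nat / a (2 * i)%nat)%C <= c3)%R) ->
    ~ converges_generally a b.
Proof.
intros a b Ha (fo & fe & Ho & He & Hne) (c & c2 & c3 & Hc & _ & _ & Hbnd).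
intros (f & v & w & Hvw & Hv & Hw).
assert (Hb : forall n, (1 <= n)%nat -> c <= Cmod (b n)) by apply Hbnd.
destruct (LimInf_seq_gt_0 _ Hvw) as (r & Hr & Hsep).
destruct (consecutive_apart _ _ _ Ho He Hne) as (eta & Heta & Hapart).
assert (Hlim : eventually (fun n => chordal (cf_convergent a b n) f < eta / 2)).
{ assert (Hclose := cf_S_close_to_convergent a b fo fe c Ha Ho He Hne Hc Hb
    (r / 2) (eta / 4) ltac:(lra) ltac:(lra)).
  rewrite is_lim_Chat_eventually in Hv, Hw.
  specialize (Hv (eta / 4) ltac:(lra)); specialize (Hw (eta / 4) ltac:(lra)).
  apply (filter_imp _ _) with
    (2 := filter_and _ _ (filter_and _ _ Hsep Hclose) (filter_and _ _ Hv Hw)).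
  intros n [[Hs Hcl] [Hvn Hwn]].
  (* [v n] and [w n] are too far apart to be both close to [Infty]. *)
  assert (Hx : exists x, r / 2 <= chordal x Infty /\
                         chordal (cf_S a b n x) f < eta / 4).
  { destruct (Rle_or_lt (r / 2) (chordal (v n) Infty)); [now exists (v n) |].
    exists (w n); split; [| exact Hwn].
    pose proof (chordal_triangle (v n) Infty (w n)).
    rewrite (chordal_sym Infty (w n)) in *; lra. }
  destruct Hx as (x & Hx & Hxf); specialize (Hcl x Hx).
  pose proof (chordal_triangle (cf_convergent a b n) (cf_S a b n x) f).
  rewrite (chordal_sym (cf_convergent a b n) (cf_S a b n x)) in *; lra. }
destruct (filter_and _ _ Hapart (filter_and _ _ Hlim (eventually_shift _ 1 Hlim)))
  as [N HN].
destruct (HN N (le_n N)) as (H1 & H2 & H3).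
pose proof (chordal_triangle (cf_convergent a b (S N)) f (cf_convergent a b N)) as H.
rewrite (chordal_sym f) in H; change (1 + N)%nat with (S N) in H3; lra.
Qed.
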